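(* For all Lebesgue measurable functions $f,g:\mathbb{R}^2\to\mathbb{R}$ and all $s,t>0$: 1. $f^*_{yx}(s,t)\le f^{**}_{yx}(s,t)$. 2. $(f+g)^{**}_{yx}(s,t)\le f^{**}_{yx}(s,t)+g^{**}_{yx}(s,t)$. 3. $f^{**}_{yx}(s,t)\le f^{**}(s,t)$; and in general $f^{**}_{yx}\ne f^{**}$ (that is, there is a measurable function $f$ for which $f^{**}_{yx}\neq f^{**}$). 4. The operator $f\mapsto f^{**}$ is not sublinear (that is, the inequality $(f+g)^{**}(s,t)\le f^{**}(s,t)+g^{**}(s,t)$ fails for some $f,g,s,t$), but $(f+g)^{**}(s,t)\le 4\big(f^{**}(s,t)+g^{**}(s,t)\big)$.
   Context: For a measurable function $h$ on $\mathbb{R}$, its decreasing rearrangement is $h^*(t)=\inf\{\sigma:|\{x:|h(x)|>\sigma\}|\le t\}$, $t>0$. For measurable $f:\mathbb{R}^2\to\mathbb{R}$, written $f(x,y)$, $f_y^*(x,t)$ is the decreasing rearrangement of $f(x,\cdot)$ evaluated at $t$ (with $x$ fixed); a subscript $x$ on a star denotes the decreasing rearrangement with respect to the first variable. Define $$f^*_{yx}(s,t)=(f_y^*(\cdot,t))^*_x(s),\qquad f^{**}(s,t)=\frac1{st}\int_0^s\int_0^tf^*_{yx}(\sigma,\tau)\,d\tau\,d\sigma,$$ $$f^{**}_{yx}(s,t)=\frac1s\int_0^s\left(\frac1t\int_0^tf_y^*(\cdot,\tau)\,d\tau\right)^*_x(\sigma)\,d\sigma.$$ *)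

(* Defs.v *)
From HB Require Import structures.
From mathcomp Require Import all_boot all_order all_algebra.
From mathcomp Require Import all_classical all_reals all_analysis.
From mathcomp Require Import measurable_realfun.

Set Implicit Arguments.
Unset Strict Implicit.
Unset Printing Implicit Defensive.

Import Order.TTheory GRing.Theory Num.Theory.
Import numFieldNormedType.Exports.

Local Open Scope classical_set_scope.
Local Open Scope ring_scope.
Local Open Scope ereal_scope.

(* The plane with its Lebesgue sigma-algebra: the completion of the Borel
   sigma-algebra of R * R with respect to the product Lebesgue measure. *)
Definition lebesgue_plane (R : realType) :=
  g_sigma_algebraType
    (completed_algebra_gen (@lebesgue_measure R \x @lebesgue_measure R)).

Definition lebesgue_measurable (R : realType) (f : R * R -> R) : Prop :=
  measurable_fun [set: lebesgue_plane R] (f : lebesgue_plane R -> R).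

(* Values may be infinite: the infimum of the empty set is +oo. Negative sigma
   contribute nothing, since their superlevel set is the whole line.
   The completed measure is used because sections of a Lebesgue measurable
   function are in general Lebesgue, and not Borel, measurable. For almost every
   x the section f(x, .) is Lebesgue measurable; on the exceptional null set,
   completed_lebesgue_measure still denotes the Lebesgue outer measure, and the
   values taken there do not affect the rearrangement in x. *)
Definition rearrangement (R : realType) (h : R -> \bar R) (t : R) : \bar R :=
  ereal_inf [set sigma%:E | sigma in
    [set sigma : R |
      completed_lebesgue_measure [set x : R | sigma%:E < `|h x|] <= t%:E]].

Definition rearrangement_y (R : realType) (f : R * R -> R) (x t : R) : \bar R :=
  rearrangement (fun y => (f (x, y))%:E) t.

Definition rearrangement_yx (R : realType) (f : R * R -> R) (s t : R) : \bar R :=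
  rearrangement (fun x => rearrangement_y f x t) s.

(* f^{**} *)
Definition dstar (R : realType) (f : R * R -> R) (s t : R) : \bar R :=
  ((s * t)^-1)%:E *
  \int[lebesgue_measure]_(sigma in `]0%R, s[)
    \int[lebesgue_measure]_(tau in `]0%R, t[) rearrangement_yx f sigma tau.

(* f^{**}_{yx} *)
Definition dstar_yx (R : realType) (f : R * R -> R) (s t : R) : \bar R :=
  (s^-1)%:E *
  \int[lebesgue_measure]_(sigma in `]0%R, s[)
    rearrangement
      (fun x => (t^-1)%:E *
        \int[lebesgue_measure]_(tau in `]0%R, t[) rearrangement_y f x tau)
      sigma.

(* Main.v *)
Require Import Defs.
From HB Require Import structures.
From mathcomp Require Import all_boot all_order all_algebra.
From mathcomp Require Import all_classical all_reals all_analysis.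
From mathcomp Require Import measurable_realfun.

Set Implicit Arguments.
Unset Strict Implicit.
Unset Printing Implicit Defensive.

Import Order.TTheory GRing.Theory Num.Theory.
Import numFieldNormedType.Exports.

Local Open Scope classical_set_scope.
Local Open Scope ring_scope.
Local Open Scope ereal_scope.

(** The inequality between the iterated rearrangement and [dstar_yx] only uses
    that a nonincreasing function is below its means, in each variable.

    The two other inequalities on [dstar_yx] rest on a variational formula. For a
    measurable [h], let [A h t] be the integral of its rearrangement over [0, t]
    ([rearrangement_integral]).
    By Cavalieri's principle, [|h|] and its rearrangement exceed a given level
    [lam >= 0] by the same amount ([integral_excess_rearrangement]), so that
      [A h t <= lam * t + \int (|h| - lam)^+],
    with equality at [lam = rearrangement h t] ([rearrangement_integralE]). Adding
    optimal levels gives the subadditivity of [A] ([rearrangement_integralD]),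
    used once in each variable for the subadditivity of [dstar_yx]; integrating
    optimal levels gives Minkowski's inequality
    ([rearrangement_integral_minkowski]), hence [dstar_yx <= dstar]. Tonelli's
    theorem is applied to Borel functions: a Lebesgue measurable function agrees
    almost everywhere with a Borel one ([completed_measurable_fun_approx]), and
    none of the quantities sees the difference.

    The quasi-subadditivity of [dstar] with constant 4 follows from
    [rearrangement l (s + t) <= rearrangement h s + rearrangement k t] for
    [|l| <= |h| + |k|], applied at doubled arguments ([dstarD_le]). The
    indicators of ]0,2] x ]0,1] and of ]0,1] x ]1,2] union ]1,2] x ]0,1] show
    that the constant 1 fails at [s = 1], [t = 2] ([dstar_not_sublinear]). Their
    sum also separates [dstar_yx] from [dstar], because [dstar_yx] is subadditive
    and below [dstar]. *)

(** * Nonincreasing functions on the line *)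

Section monotone_functions.
Context {R : realType}.
Local Notation mu := (@lebesgue_measure R).

Lemma nonincreasing_emeasurable (D : set R) (phi : R -> \bar R) :
  measurable D -> {homo phi : s t / (s <= t)%R >-> t <= s} ->
  measurable_fun D phi.
Proof.
move=> mD phi_ni; apply: (measurability _ (ErealGenOInfty.measurableE R)).
move=> /= _ [_ [r ->] <-]; apply: measurableI => //.
apply: is_interval_measurable => s t /=.
rewrite !in_itv/= !andbT => _ rt u /andP[_ ut].
by rewrite in_itv/= andbT (lt_le_trans rt)// phi_ni.
Qed.

(** A nonincreasing function is below its mean over [0, t]. *)
Lemma nonincreasing_le_mean (phi : R -> \bar R) (t : R) : (0 < t)%R ->
  {homo phi : s t / (s <= t)%R >-> t <= s} -> (forall s, 0 <= phi s) ->
  phi t <= (t^-1)%:E * \int[mu]_(tau in `]0%R, t[) phi tau.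
Proof.
move=> t0 phi_ni phi0.
rewrite -(@lee_pmul2l _ t%:E)//.
rewrite muleA -EFinM divff ?gt_eqF// mul1e.
have -> : t%:E * phi t = \int[mu]_(tau in `]0%R, t[) cst (phi t) tau.
  by rewrite integral_cst//= lebesgue_measure_itv/= lte_fin t0 sube0 muleC.
apply: ge0_le_integral => //.
- by move=> *; exact: phi0.
- exact: nonincreasing_emeasurable.
- by move=> tau /=; rewrite in_itv/= => /andP[_ /ltW]; exact: phi_ni.
Qed.

(** The substitution [tau = 2 sigma] gives twice the integral over [0, t / 2],
    which is enlarged to [0, t]. *)
Lemma integral_double_le (phi : R -> \bar R) (t : R) : (0 < t)%R ->
  {homo phi : s t / (s <= t)%R >-> t <= s} -> (forall s, 0 <= phi s) ->
  \int[mu]_(tau in `]0%R, t[) phi tau <=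
  2%:E * \int[mu]_(tau in `]0%R, t[) phi (2 * tau)%R.
Proof.
move=> t0 phi_ni phi0.
pose dbl (x : measurableTypeR R) : measurableTypeR R := (2 * x)%R.
have mdbl : measurable_fun setT dbl by exact: mulrl_measurable.
have dblE (a b : R) (x y : bool) : dbl @^-1` [set` Interval (BSide x a) (BSide y b)] =
    [set` Interval (BSide x (a / 2)%R) (BSide y (b / 2)%R)].
  by apply/seteqP; split => z /=; rewrite /dbl !in_itv/=;
    case: x; case: y => /=; rewrite ?ler_pdivrMr ?ltr_pdivrMr ?ler_pdivlMr
      ?ltr_pdivlMr// mulrC.
have munu A : measurable A ->
    mu A = mscale (NngNum (ler0n R 2)) (pushforward mu dbl) A.
  apply: lebesgue_measure_unique => _ [[a b]] _ <-.
  transitivity (2%:E * mu (dbl @^-1` `]a, b])); last by [].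
  rewrite dblE !lebesgue_measure_itv/= !lte_fin.
  rewrite ltr_pM2r ?invr_gt0//; case: ifPn => ab; last by rewrite mule0.
  by rewrite -!EFinB -EFinM -mulrBl mulrC divfK.
have mphi : measurable_fun `]0%R, t[ phi by exact: nonincreasing_emeasurable.
rewrite (eq_measure_integral (mscale (NngNum (ler0n R 2)) (pushforward mu dbl))); last first.
  by move=> A mA _; exact: munu.
rewrite ge0_integral_mscale//= ge0_integral_pushforward//=.
rewrite dblE mul0r lee_pmul2l//.
apply: ge0_subset_integral => //=.
- apply: nonincreasing_emeasurable => // s s' ss'.
  by apply: phi_ni; rewrite /dbl ler_pM2l.
- by move=> x /=; rewrite !in_itv/= => /andP[-> /lt_le_trans->]//=;
    rewrite ler_pdivrMr// ler_pMr// ler1n.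
Qed.

End monotone_functions.

(** * Order properties of the rearrangement *)

Section rearrangement_basics.
Context {R : realType}.
Implicit Types (h k l : R -> \bar R) (A B : set R) (r s t : R).
Local Notation mu := (@lebesgue_measure R).

(** [lebesgue_measure] is the Lebesgue outer measure, so that monotonicity and
    subadditivity need no measurability. *)
Lemma lebesgue_measureS A B : A `<=` B -> mu A <= mu B.
Proof. exact: (@le_outer_measure _ _ ((wlength idfun)^*)%mu). Qed.

Lemma lebesgue_measureU_le A B : mu (A `|` B) <= mu A + mu B.
Proof. exact: (outer_measureU2 ((wlength idfun)^*)%mu). Qed.

(** The distribution function of [|h|]. *)
Definition distribution_fun h r : \bar R := mu [set x | r%:E < `|h x|].

(** The completed Lebesgue measure and the Lebesgue measure are the same outer
    measure, on two sigma-algebras. *)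
Lemma rearrangementE h t : rearrangement h t =
  ereal_inf [set r%:E | r in [set r | distribution_fun h r <= t%:E]].
Proof. by []. Qed.

Lemma rearrangement_ge0 h t : 0 <= rearrangement h t.
Proof.
rewrite rearrangementE; apply: le_ereal_inf_tmp => _ [r /= hrt <-].
(* The superlevel set of a negative level is the whole line. *)
rewrite lee_fin leNgt; apply/negP => r0; move: hrt; rewrite leNgt => /negP; apply.
rewrite /distribution_fun (_ : [set _ | _] = setT); last first.
  by apply/seteqP; split => // x _ /=; rewrite (lt_le_trans _ (abse_ge0 _))// lte_fin.
by rewrite -set_itvNyy lebesgue_measure_itv/= ltry.
Qed.

Lemma rearrangement_nonincreasing h :
  {homo rearrangement h : s t / (s <= t)%R >-> t <= s}.
Proof.
move=> s t st; apply: ereal_inf_le_tmp => _ [r hr <-]; exists r => //.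
by rewrite /= (le_trans hr)// lee_fin.
Qed.

Lemma le_rearrangement_distribution h k t :
  (forall r, distribution_fun h r <= distribution_fun k r) ->
  rearrangement h t <= rearrangement k t.
Proof.
move=> hk; apply: ereal_inf_le_tmp => _ [r kr <-]; exists r => //=.
exact: le_trans (hk r) kr.
Qed.

Lemma le_rearrangement h k t : (forall x, `|h x| <= `|k x|) ->
  rearrangement h t <= rearrangement k t.
Proof.
move=> hk; apply: le_rearrangement_distribution => r.
by apply: lebesgue_measureS => x /= /lt_le_trans; exact.
Qed.

Lemma rearrangement_le h r t :
  mu [set x | r%:E < `|h x|] <= t%:E -> rearrangement h t <= r%:E.
Proof. by move=> hrt; apply: ereal_inf_lbound; exists r. Qed.

Lemma rearrangement_ge h r t :
  t%:E < mu [set x | r%:E <= `|h x|] -> r%:E <= rearrangement h t.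
Proof.
move=> hrt; apply: le_ereal_inf_tmp => _ [r' /= hr' <-].
rewrite lee_fin leNgt; apply/negP => r'r.
move: hrt; rewrite ltNge => /negP; apply; apply: le_trans hr'.
by apply: lebesgue_measureS => x /=; apply: lt_le_trans; rewrite lte_fin.
Qed.

(** Subadditivity, at the price of splitting the argument; it holds for
    arbitrary functions. *)
Lemma rearrangementD h k l s t : (forall x, `|l x| <= `|h x| + `|k x|) ->
  rearrangement l (s + t)%R <= rearrangement h s + rearrangement k t.
Proof.
move=> lhk.
have [|hy] := leP +oo (rearrangement h s).
  rewrite leye_eq => /eqP ->.
  by rewrite addye ?leey// gt_eqF// (lt_le_trans _ (rearrangement_ge0 _ _)).
have [|ky] := leP +oo (rearrangement k t).
  rewrite leye_eq => /eqP ->.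
  by rewrite addey ?leey// gt_eqF// (lt_le_trans _ (rearrangement_ge0 _ _)).
have hfin : rearrangement h s \is a fin_num by rewrite ge0_fin_numE ?rearrangement_ge0.
have kfin : rearrangement k t \is a fin_num by rewrite ge0_fin_numE ?rearrangement_ge0.
apply/lee_addgt0Pr => e e0; have e20 : (0 < e / 2)%R by rewrite divr_gt0.
have [_ [a /= ha <-] ae] := lb_ereal_inf_adherent e20 hfin.
have [_ [b /= kb <-] be] := lb_ereal_inf_adherent e20 kfin.
apply: (@le_trans _ _ (a + b)%:E).
  apply: ereal_inf_lbound; exists (a + b)%R => //=.
  apply: (@le_trans _ _ (distribution_fun h a + distribution_fun k b)).
    apply: le_trans (lebesgue_measureU_le _ _).
    apply: lebesgue_measureS => x /= ablx.
    have [hax|hax] := ltP a%:E `|h x|; first by left.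
    have [kbx|kbx] := ltP b%:E `|k x|; first by right.
    move: ablx; rewrite ltNge => /negP; case; apply: le_trans (lhk x) _.
    by rewrite EFinD leeD.
  by rewrite EFinD leeD.
rewrite [e]splitr !EFinD addeACA ltW//; exact: lteD.
Qed.

End rearrangement_basics.

(** * The rearrangement of a measurable function *)

Section measurable_rearrangement.
Context {R : realType}.
Implicit Types (h k l : R -> \bar R) (r s t : R).
Local Notation mu := (@lebesgue_measure R).

Lemma measurable_superlevel (h : R -> \bar R) (r : R) : measurable_fun setT h ->
  measurable [set x | r%:E < `|h x|].
Proof.
move=> mh; rewrite -[X in measurable X]setTI.
by apply: emeasurable_fun_o_infty => //; exact: measurableT_comp.
Qed.

(** The rearrangement of a measurable function is the generalised inverse of
    its distribution function; the converse implication uses the right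
    continuity of the latter. *)
Lemma lt_rearrangement h r t : measurable_fun setT h ->
  (r%:E < rearrangement h t) = (t%:E < distribution_fun h r).
Proof.
move=> mh; apply/idP/idP => [|tr].
  by apply: contraLR; rewrite -!leNgt; exact: rearrangement_le.
(* The superlevel set at [r] is the increasing union of those at [r + 1/(n+1)]. *)
pose F (n : nat) := [set x | (r + n.+1%:R^-1)%:E < `|h x|].
have bF : \bigcup_n F n = [set x | r%:E < `|h x|].
  apply/seteqP; split => [x [n _] /=|x /= rx].
    by apply: lt_trans; rewrite lte_fin ltrDl.
  have [q rq qx] : exists2 q : R, (r < q)%R & q%:E < `|h x|.
    case: `|h x| rx => [q| |//].
      rewrite lte_fin => rq; exists ((r + q) / 2)%R; first by rewrite midf_lt.
      by rewrite lte_fin midf_lt.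
    by move=> _; exists (r + 1)%R; rewrite ?ltrDl ?ltry.
  have qr0 : (0 < q - r)%R by rewrite subr_gt0.
  near \oo => n; exists n => //=.
  apply: lt_trans qx; rewrite lte_fin -ltrBrDl.
  by near: n; exact: (near_infty_natSinv_lt (PosNum qr0)).
have mF n : measurable (F n) by exact: measurable_superlevel.
have ndF : {homo F : n m / (n <= m)%N >-> (n <= m)%O}.
  move=> n m nm; apply/subsetPset => x /=; apply: le_lt_trans.
  by rewrite lee_fin lerD2l lef_pV2 ?posrE// ler_nat.
have cvgF := @nondecreasing_cvg_mu _ _ _ mu F mF (bigcupT_measurable _ mF) ndF.
have [n tn] : exists n, t%:E < mu (F n).
  apply/not_existsP => tF.
  move: tr; rewrite ltNge => /negP; apply.
  rewrite /distribution_fun -bF -(cvg_lim _ cvgF)//.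
  apply: lime_le; first by apply/cvg_ex; eexists; exact: cvgF.
  by near=> n; rewrite leNgt; apply/negP; exact: tF.
apply: (@lt_le_trans _ _ (r + n.+1%:R^-1)%:E); first by rewrite lte_fin ltrDl.
apply: rearrangement_ge; apply: lt_le_trans tn _.
by apply: lebesgue_measureS => x /= /ltW.
Unshelve. all: by end_near. Qed.

Lemma measurable_rearrangement h (D : set R) : measurable D ->
  measurable_fun D (rearrangement h).
Proof.
by move=> mD; apply: nonincreasing_emeasurable => //;
  exact: rearrangement_nonincreasing.
Qed.

(** Joint measurability of the rearrangement of a measurable family. *)
Lemma measurable_rearrangement_family d (T : measurableType d)
    (G : T * R -> \bar R) : measurable_fun setT G ->
  measurable_fun setT (fun z : T * R => rearrangement (fun y => G (z.1, y)) z.2).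
Proof.
move=> mG; apply: (measurability _ (ErealGenOInfty.measurableE R)).
move=> /= _ [_ [r ->] <-]; apply: measurableI => //.
pose A : set (T * R) := [set z | r%:E < `|G z|].
have mA : measurable A.
  rewrite -[X in measurable X]setTI.
  by apply: emeasurable_fun_o_infty => //; exact: measurableT_comp.
have distrE x : distribution_fun (fun y => G (x, y)) r = mu (xsection A x).
  by congr (mu _); apply/seteqP; split => y; rewrite /xsection/= in_setE.
(* By [lt_rearrangement], the superlevel set at [r] is the region under the graph
   of the distribution function at [r], which is measurable in the parameter. *)
rewrite (_ : _ @^-1` _ = setT `&` [set z : T * R | z.2%:E < mu (xsection A z.1)]).
  apply: measurable_lte => //; first by apply/measurable_EFinP; exact: measurable_snd.
  apply: (@measurableT_comp _ _ _ _ _ _ (mu \o xsection A)) => //.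
  exact: measurable_fun_xsection.
rewrite setTI; apply/seteqP; split => -[x t]; rewrite /= in_itv/= andbT -distrE.
  by rewrite lt_rearrangement//; exact: measurableT_comp.
by rewrite lt_rearrangement//; exact: measurableT_comp.
Qed.

End measurable_rearrangement.

(** * Excess over a level and equimeasurability *)

Section excess.
Context {R : realType}.
Implicit Types w e lam : \bar R.

(** The positive part of [w - lam]; it vanishes when [lam] is [+oo]. *)
Definition excess lam w : \bar R := maxe (w - lam) 0.

Lemma excess_ge0 lam w : 0 <= excess lam w.
Proof. by rewrite le_max lexx orbT. Qed.

Lemma le_add_excess lam w : 0 <= lam -> w <= lam + excess lam w.
Proof.
case: lam => [lam _| _|//]; last by rewrite addye ?leey// gt_eqF// (lt_le_trans _ (excess_ge0 _ _)).
by rewrite -leeBlDl// le_max lexx.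
Qed.

Lemma excess_le lam w e : 0 <= lam -> 0 <= e -> w <= lam + e -> excess lam w <= e.
Proof.
move=> lam0 e0 wle; rewrite ge_max e0 andbT.
case: lam lam0 wle => [lam _|_ _|//]; last by rewrite addeNy (le_trans _ e0)// leNye.
by rewrite -leeBlDl.
Qed.

Lemma excess_eq0 lam w : w <= lam -> excess lam w = 0.
Proof.
move=> wlam; apply/eqP; rewrite eq_le excess_ge0 andbT ge_max lexx andbT.
by rewrite sube_le0.
Qed.

Lemma measurable_excess d (T : measurableType d) (D : set T) (lam w : T -> \bar R) :
  measurable_fun D lam -> measurable_fun D w ->
  measurable_fun D (fun x => excess (lam x) (w x)).
Proof.
move=> mlam mw; apply: measurable_maxe => //.
exact: emeasurable_funB.
Qed.

End excess.

Section layer_cake.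
Context {R : realType}.
Local Notation mu := (@lebesgue_measure R).

(** Cavalieri's principle: both sides are the measure of the region between the
    level [lam] and the graph of [w]. *)
Lemma integral_excess d (T : measurableType d)
    (m : {sigma_finite_measure set T -> \bar R}) (w : T -> \bar R) (lam : R) :
  measurable_fun setT w ->
  \int[m]_x excess lam%:E (w x) =
  \int[mu]_(r in `]lam, +oo[) m [set x | r%:E < w x].
Proof.
move=> mw.
pose A : set (T * R) := [set z | (lam < z.2)%R /\ z.2%:E < w z.1].
have m2 : measurable_fun setT (fun z : T * R => z.2%:E).
  by apply/measurable_EFinP; exact: measurable_snd.
have mA : measurable A.
  rewrite (_ : A = (setT `&` [set z : T * R | lam%:E < z.2%:E]) `&`
    (setT `&` [set z : T * R | z.2%:E < w z.1])).
    by apply: measurableI; apply: measurable_lte => //;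
      apply: (measurableT_comp mw); exact: measurable_fst.
  by rewrite !setTI.
have FA := @indic_fubini_tonelli_FE _ _ T (measurableTypeR R) R mu A mA.
have GA := @indic_fubini_tonelli_GE _ _ T (measurableTypeR R) R m A mA.
have := @indic_fubini_tonelli _ _ T (measurableTypeR R) R m mu A mA.
have GE : \int[mu]_(y in [set: measurableTypeR R]) (m \o ysection A) y =
    \int[mu]_(r in `]lam, +oo[) m [set x | r%:E < w x].
  rewrite [RHS]integral_mkcond; apply: eq_integral => r _ /=.
  rewrite patchE; case: ifPn => [|]; rewrite ?inE ?notin_setE /= in_itv/= andbT => lr.
    by congr (m _); apply/seteqP; split => x; rewrite /ysection/= in_setE /A/=; tauto.
  rewrite (_ : ysection A r = set0) ?measure0//.
  by apply/seteqP; split => x //; rewrite /ysection/= in_setE /A/= => -[].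
have FE : \int[m]_x (mu \o xsection A) x = \int[m]_x excess lam%:E (w x).
  apply: eq_integral => x _ /=.
  have -> : xsection A x = [set r | (lam < r)%R /\ r%:E < w x].
    by apply/seteqP; split => r; rewrite /xsection/= in_setE /A/=.
  rewrite /excess; case: (w x) => [c| |].
  - rewrite (_ : [set _ | _] = `]lam, c[%classic); last first.
      by apply/seteqP; split => r /=; rewrite in_itv/= lte_fin; [case=> -> ->|move/andP].
    rewrite lebesgue_measure_itv/= lte_fin -EFinB.
    case: ltP => lc; first by rewrite max_l// lee_fin subr_ge0 ltW.
    by rewrite max_r// lee_fin subr_le0.
  - rewrite (_ : [set _ | _] = `]lam, +oo[%classic); last first.
      by apply/seteqP; split => r /=; rewrite in_itv/= andbT ltry; [case|].
    by rewrite lebesgue_measure_itv/= ltry max_l// leey.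
  - rewrite (_ : [set _ | _] = set0); first by rewrite measure0 addNye max_r// leNye.
    by apply/seteqP; split => r //= -[_]; rewrite ltNge leNye.
by rewrite FA GA GE FE.
Qed.

(** The initial segment of length [c]; [c] may be infinite. *)
Lemma lebesgue_measure_initial_segment (c : \bar R) : 0 <= c ->
  mu [set tau : R | (0 < tau)%R /\ tau%:E < c] = c.
Proof.
case: c => [c c0|_|//].
  rewrite (_ : [set _ | _] = `]0%R, c[%classic); last first.
    by apply/seteqP; split => r /=; rewrite in_itv/= lte_fin; [case=> -> ->|move/andP].
  rewrite lebesgue_measure_itv/= lte_fin sube0.
  by move: c0; rewrite lee_fin le_eqVlt => /predU1P[<-|->//]; rewrite ltxx.
rewrite (_ : [set _ | _] = `]0%R, +oo[%classic); last first.
  by apply/seteqP; split => r /=; rewrite in_itv/= andbT ltry; [case|].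
by rewrite lebesgue_measure_itv/= ltry.
Qed.

(** A function and its rearrangement are equimeasurable, hence exceed a given
    nonnegative level by the same amount. *)
Lemma integral_excess_rearrangement (h : R -> \bar R) (lam : R) :
  measurable_fun setT h -> (0 <= lam)%R ->
  \int[mu]_x excess lam%:E `|h x| =
  \int[mu]_(tau in `]0%R, +oo[) excess lam%:E (rearrangement h tau).
Proof.
(* Extension of the rearrangement by 0 adds no excess, as [lam >= 0]. *)
move=> mh lam0; pose k := rearrangement h \_ `]0%R, +oo[%classic.
transitivity (\int[mu]_x excess lam%:E (k x)); last first.
  rewrite [RHS]integral_mkcond; apply: eq_integral => tau _.
  by rewrite /k !patchE; case: ifPn => // _; rewrite excess_eq0.
rewrite !integral_excess//.
- apply: eq_integral => r; rewrite inE/= in_itv/= andbT => lamr.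
  rewrite -[LHS]lebesgue_measure_initial_segment//.
  congr (mu _); apply/seteqP; split => tau /=; rewrite /k patchE.
    move=> [tau0 hr]; rewrite ifT; first by rewrite lt_rearrangement.
    by rewrite inE/= in_itv/= tau0.
  case: ifPn; rewrite ?inE/= ?in_itv/= ?andbT => tau0.
    by rewrite lt_rearrangement.
  by rewrite lte_fin ltNge (le_trans lam0 (ltW lamr)).
- apply/(measurable_restrictT _ _).1 => //; exact: measurable_rearrangement.
- exact: measurableT_comp.
Qed.

End layer_cake.

(** * The integral of the rearrangement *)

Section rearrangement_integral.
Context {R : realType}.
Implicit Types (h k l : R -> \bar R) (r s t : R).
Local Notation mu := (@lebesgue_measure R).

(** The integral of the rearrangement over [0, t], that is, [t] times the
    maximal function of [h] at [t]. *)
Definition rearrangement_integral h t : \bar R :=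
  \int[mu]_(tau in `]0%R, t[) rearrangement h tau.

Lemma rearrangement_integral_ge0 h t : 0 <= rearrangement_integral h t.
Proof. by apply: integral_ge0 => tau _; exact: rearrangement_ge0. Qed.

Lemma integral_cst_initial (c : \bar R) t : (0 < t)%R ->
  \int[mu]_(tau in `]0%R, t[) c = c * t%:E.
Proof.
by move=> t0; rewrite integral_cst//= lebesgue_measure_itv/= lte_fin t0 sube0.
Qed.

(** Splitting [|h|] at an arbitrary height [lam]. *)
Lemma rearrangement_integral_le h t (lam : \bar R) : measurable_fun setT h ->
  (0 < t)%R -> 0 <= lam ->
  rearrangement_integral h t <= lam * t%:E + \int[mu]_x excess lam `|h x|.
Proof.
move=> mh t0; case: lam => [lam lam0|_|//]; last first.
  rewrite gt0_mulye// addye ?leey// gt_eqF// (@lt_le_trans _ _ 0)//.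
  by apply: integral_ge0 => x _; exact: excess_ge0.
have mr D : measurable D -> measurable_fun D (rearrangement h).
  exact: measurable_rearrangement.
have me D : measurable D -> measurable_fun D (fun tau => excess lam%:E (rearrangement h tau)).
  by move=> mD; apply: measurable_excess => //; exact: mr.
apply: (@le_trans _ _ (\int[mu]_(tau in `]0%R, t[)
    (lam%:E + excess lam%:E (rearrangement h tau)))).
  apply: ge0_le_integral => //.
  - by move=> tau _; exact: rearrangement_ge0.
  - exact: mr.
  - by apply: emeasurable_funD => //; exact: me.
  - by move=> tau _; exact: le_add_excess.
rewrite ge0_integralD//; last 2 first.
  - by move=> tau _; exact: excess_ge0.
  - exact: me.
rewrite integral_cst_initial// leeD2l// integral_excess_rearrangement//.
apply: ge0_subset_integral => //.
- exact: me.
- by move=> tau _; exact: excess_ge0.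
- by move=> tau /=; rewrite !in_itv/= andbT => /andP[].
Qed.

(** The optimal height is [rearrangement h t]: there the excess of the
    rearrangement lives on [0, t], where the rearrangement exceeds the height. *)
Lemma rearrangement_integral_ge h t : measurable_fun setT h -> (0 < t)%R ->
  rearrangement h t * t%:E + \int[mu]_x excess (rearrangement h t) `|h x| <=
  rearrangement_integral h t.
Proof.
move=> mh t0.
have mr D : measurable D -> measurable_fun D (rearrangement h).
  exact: measurable_rearrangement.
have [lamy|lamy] := leP +oo (rearrangement h t).
  have hty : rearrangement h t = +oo by apply/eqP; rewrite -leye_eq.
  rewrite hty (_ : \int[mu]_x _ = 0); last first.
    by apply: integral0_eq => x _; rewrite excess_eq0// leey.
  rewrite adde0 -integral_cst_initial//; apply: ge0_le_integral => //.
  - exact: mr.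
  - move=> tau /=; rewrite in_itv/= => /andP[_ /ltW taut].
    by rewrite -hty rearrangement_nonincreasing.
have : rearrangement h t \is a fin_num by rewrite ge0_fin_numE ?rearrangement_ge0.
move=> /fineK; set lam := fine _ => lamE.
have lam0 : (0 <= lam)%R by rewrite -lee_fin lamE rearrangement_ge0.
have me D : measurable D -> measurable_fun D (fun tau => excess lam%:E (rearrangement h tau)).
  by move=> mD; apply: measurable_excess => //; exact: mr.
rewrite -lamE integral_excess_rearrangement//.
rewrite (@itv_bndbnd_setU _ _ _ (BLeft t))//.
rewrite ge0_integral_setU//=; last 3 first.
- by apply: me; exact: measurableU.
- by move=> tau _; exact: excess_ge0.
- by apply/disj_setPS => tau /=; rewrite !in_itv/= andbT => -[/andP[_]]; rewrite ltNge => /negP.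
rewrite [X in _ + (_ + X)]integral0_eq ?adde0; last first.
  move=> tau /=; rewrite in_itv/= andbT => ttau.
  by rewrite excess_eq0// lamE rearrangement_nonincreasing.
rewrite -integral_cst_initial// -ge0_integralD//; last 2 first.
- by move=> tau _; exact: excess_ge0.
- exact: me.
apply: ge0_le_integral => //.
- by move=> tau _; rewrite adde_ge0// excess_ge0.
- by apply: emeasurable_funD => //; exact: me.
- exact: mr.
move=> tau /=; rewrite in_itv/= => /andP[_ /ltW taut].
have lamtau : lam%:E <= rearrangement h tau by rewrite lamE rearrangement_nonincreasing.
by rewrite /excess max_l ?sube_ge0// addeC subeK.
Qed.

(** The variational formula: the minimum over [lam] of the right-hand side of
    [rearrangement_integral_le] is attained at [rearrangement h t]. *)
Lemma rearrangement_integralE h t : measurable_fun setT h -> (0 < t)%R ->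
  rearrangement_integral h t =
  rearrangement h t * t%:E + \int[mu]_x excess (rearrangement h t) `|h x|.
Proof.
move=> mh t0; apply/eqP; rewrite eq_le rearrangement_integral_ge// andbT.
by rewrite rearrangement_integral_le// rearrangement_ge0.
Qed.

(** Heights that are optimal for [h] and [k] add up to an admissible height for
    [l], and the excesses add up as well. *)
Lemma rearrangement_integralD h k l t : measurable_fun setT h ->
  measurable_fun setT k -> measurable_fun setT l -> (0 < t)%R ->
  (forall x, `|l x| <= `|h x| + `|k x|) ->
  rearrangement_integral l t <=
  rearrangement_integral h t + rearrangement_integral k t.
Proof.
move=> mh mk ml t0 lhk; rewrite (rearrangement_integralE mh)//.
rewrite (rearrangement_integralE mk)//.
set a := rearrangement h t; set b := rearrangement k t.
have a0 : 0 <= a by exact: rearrangement_ge0.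
have b0 : 0 <= b by exact: rearrangement_ge0.
apply: le_trans (rearrangement_integral_le ml t0 (adde_ge0 a0 b0)) _.
have mea : measurable_fun setT (fun x => excess a `|h x|).
  by apply: measurable_excess => //; exact: measurableT_comp.
have meb : measurable_fun setT (fun x => excess b `|k x|).
  by apply: measurable_excess => //; exact: measurableT_comp.
rewrite addeACA ge0_muleDl// leeD2l// -ge0_integralD//; last 2 first.
- by move=> x _; exact: excess_ge0.
- by move=> x _; exact: excess_ge0.
apply: ge0_le_integral => //.
- by move=> x _; exact: excess_ge0.
- by apply: measurable_excess => //; exact: measurableT_comp.
- exact: emeasurable_funD.
move=> x _; apply: excess_le; rewrite ?adde_ge0 ?excess_ge0//.
apply: le_trans (lhk x) _; rewrite addeACA.
by apply: leeD; exact: le_add_excess.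
Qed.

Lemma ge0_rearrangement_integralD h k l t : measurable_fun setT h ->
  measurable_fun setT k -> measurable_fun setT l -> (0 < t)%R ->
  (forall x, 0 <= h x) -> (forall x, 0 <= k x) -> (forall x, 0 <= l x) ->
  (forall x, l x <= h x + k x) ->
  rearrangement_integral l t <=
  rearrangement_integral h t + rearrangement_integral k t.
Proof.
move=> mh mk ml t0 h0 k0 l0 lhk; apply: rearrangement_integralD => // x.
by rewrite !gee0_abs.
Qed.

Lemma rearrangement_scale_le (c : R) h t : (0 < c)%R ->
  rearrangement (fun x => c%:E * h x) t <= c%:E * rearrangement h t.
Proof.
move=> c0; rewrite muleC -lee_pdivrMr//; apply: le_ereal_inf_tmp => _ [r /= hr <-].
rewrite lee_pdivrMr// -EFinM; apply: rearrangement_le; apply: le_trans hr.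
apply: lebesgue_measureS => x /=.
by rewrite abseM gee0_abs ?lee_fin ?ltW// muleC EFinM lte_pmul2r.
Qed.

Lemma rearrangement_integral_scale_le (c : R) h t : (0 < c)%R ->
  rearrangement_integral (fun x => c%:E * h x) t <= c%:E * rearrangement_integral h t.
Proof.
move=> c0; rewrite -ge0_integralZl//; last 3 first.
- exact: measurable_rearrangement.
- by move=> tau _; exact: rearrangement_ge0.
- by rewrite lee_fin ltW.
apply: ge0_le_integral => //.
- by move=> tau _; exact: rearrangement_ge0.
- exact: measurable_rearrangement.
- by apply: measurable_funeM; exact: measurable_rearrangement.
- by move=> tau _; exact: rearrangement_scale_le.
Qed.

End rearrangement_integral.

(** * Minkowski's integral inequality *)

Section tonelli_on_rectangles.
Context d1 d2 (T1 : measurableType d1) (T2 : measurableType d2) (R : realType).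
Variables (m1 : {sigma_finite_measure set T1 -> \bar R}).
Variables (m2 : {sigma_finite_measure set T2 -> \bar R}).
Variables (D1 : set T1) (D2 : set T2) (f : T1 * T2 -> \bar R).
Hypotheses (mD1 : measurable D1) (mD2 : measurable D2).
Hypotheses (mf : measurable_fun setT f) (f0 : forall z, 0 <= f z).

Let fD := f \_ (D1 `*` D2).

Let mfD : measurable_fun setT fD.
Proof.
apply/(measurable_restrictT _ _).1; first exact: measurableX.
exact: measurable_funTS.
Qed.

Let fD0 z : 0 <= fD z. Proof. by rewrite /fD patchE; case: ifPn. Qed.

Let sectionE x : \int[m2]_y fD (x, y) = ((fun x => \int[m2]_(y in D2) f (x, y)) \_ D1) x.
Proof.
rewrite patchE; case: ifPn => xD.
  rewrite [RHS]integral_mkcond; apply: eq_integral => y _.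
  by rewrite /fD !patchE in_setX xD.
by apply: integral0_eq => y _; rewrite /fD patchE in_setX (negbTE xD).
Qed.

Lemma fubini_tonelli_setX :
  \int[m1]_(x in D1) \int[m2]_(y in D2) f (x, y) =
  \int[m2]_(y in D2) \int[m1]_(x in D1) f (x, y).
Proof.
transitivity (\int[m1]_x \int[m2]_y fD (x, y)).
  by rewrite integral_mkcond; apply: eq_integral => x _; rewrite sectionE.
rewrite fubini_tonelli// [RHS]integral_mkcond; apply: eq_integral => y _.
rewrite patchE; case: ifPn => yD.
  rewrite [RHS]integral_mkcond; apply: eq_integral => x _.
  by rewrite /fD !patchE in_setX yD andbT.
by apply: integral0_eq => x _; rewrite /fD patchE in_setX (negbTE yD) andbF.
Qed.

Lemma measurable_fun_integral_section :
  measurable_fun D1 (fun x => \int[m2]_(y in D2) f (x, y)).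
Proof.
apply/(measurable_restrictT _ _).2 => //.
rewrite (_ : _ \_ _ = (fun x => \int[m2]_y fD (x, y))); last first.
  by apply/funext => x; rewrite sectionE.
exact: (measurable_fun_fubini_tonelli_F fD).
Qed.

End tonelli_on_rectangles.

Section minkowski.
Context {R : realType} d (T : measurableType d).
Variables (m : {sigma_finite_measure set T -> \bar R}).
Local Notation mu := (@lebesgue_measure R).

(** Minkowski's integral inequality for the integral of the rearrangement: the
    heights at which the sections are cut are integrated along with them. *)
Lemma rearrangement_integral_minkowski (D : set T) (G : R * T -> \bar R) (s : R) :
  measurable D -> measurable_fun setT G -> (forall z, 0 <= G z) -> (0 < s)%R ->
  rearrangement_integral (fun x => \int[m]_(y in D) G (x, y)) s <=
  \int[m]_(y in D) rearrangement_integral (fun x => G (x, y)) s.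
Proof.
move=> mD mG G0 s0.
pose lam y := rearrangement (fun x => G (x, y)) s.
have lam0 y : 0 <= lam y by exact: rearrangement_ge0.
have mlam : measurable_fun setT lam.
  have mGs : measurable_fun setT (G \o (fun z : T * R => (z.2, z.1))).
    by apply: measurableT_comp => //; exact: measurable_fun_pair.
  exact: (@measurableT_comp _ _ _ _ _ _ _ _ _ (measurable_rearrangement_family mGs)
    (measurable_fun_pair (@measurable_id _ _ _) (measurable_cst s))).
have mG1 y : measurable_fun setT (fun x => G (x, y)) by exact: measurable_fun_pair1.
have mG2 x : measurable_fun setT (fun y => G (x, y)) by exact: measurable_fun_pair2.
pose e z := excess (lam z.2) (G z).
have e0 z : 0 <= e z by exact: excess_ge0.
have me : measurable_fun setT e.
  apply: measurable_excess => //.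
  by apply: (measurableT_comp mlam); exact: measurable_snd.
have me2 x : measurable_fun setT (fun y => e (x, y)) by exact: measurable_fun_pair2.
have mint : measurable_fun setT (fun x => \int[m]_(y in D) G (x, y)).
  exact: measurable_fun_integral_section.
pose Lam := \int[m]_(y in D) lam y.
have Lam0 : 0 <= Lam by exact: integral_ge0.
apply: le_trans (rearrangement_integral_le mint s0 Lam0) _.
apply: (@le_trans _ _ (Lam * s%:E + \int[mu]_x \int[m]_(y in D) e (x, y))).
  rewrite leeD2l//; apply: ge0_le_integral => //.
  - by move=> x _; exact: excess_ge0.
  - by apply: measurable_excess => //; exact: measurableT_comp.
  - exact: measurable_fun_integral_section.
  move=> x _; apply: excess_le => //; first exact: integral_ge0.
  rewrite gee0_abs; last exact: integral_ge0.
  rewrite -ge0_integralD//; last 2 first.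
  - exact: measurable_funTS.
  - exact: measurable_funTS.
  apply: ge0_le_integral => //.
  - exact: measurable_funTS.
  - by apply: emeasurable_funD; exact: measurable_funTS.
  - by move=> y _; exact: le_add_excess.
rewrite (@fubini_tonelli_setX _ _ _ _ _ mu m setT D e)//.
rewrite muleC -ge0_integralZl//; last 2 first.
- exact: measurable_funTS.
- by rewrite lee_fin ltW.
rewrite -ge0_integralD//; last 4 first.
- by move=> y _; rewrite mule_ge0// lee_fin ltW.
- by apply: measurable_funeM; exact: measurable_funTS.
- by move=> y _; exact: integral_ge0.
- by apply: measurable_funTS; exact: (@measurable_fun_fubini_tonelli_G _ _ _ T R mu e me e0).
rewrite le_eqVlt; apply/orP; left; apply/eqP; apply: eq_integral => y _.
rewrite rearrangement_integralE// muleC; congr (_ + _).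
by apply: eq_integral => x _; rewrite gee0_abs.
Qed.

End minkowski.

(** * Iterated rearrangements *)

Section iterated_rearrangement.
Context {R : realType}.
Implicit Types (f g : R * R -> R) (s t : R).
Local Notation mu := (@lebesgue_measure R).

(** The mean over [0, t] of the rearrangement of [f(x, .)]. *)
Definition mean_y f t (x : R) : \bar R :=
  (t^-1)%:E * \int[mu]_(tau in `]0%R, t[) rearrangement_y f x tau.

Lemma dstar_yxE f s t :
  dstar_yx f s t = (s^-1)%:E * rearrangement_integral (mean_y f t) s.
Proof. by []. Qed.

Lemma mean_y_ge0 f t x : (0 < t)%R -> 0 <= mean_y f t x.
Proof.
move=> t0; rewrite mule_ge0 ?lee_fin ?invr_ge0 ?(ltW t0)//.
by apply: integral_ge0 => tau _; exact: rearrangement_ge0.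
Qed.

Lemma rearrangement_yx_nonincreasing1 f t :
  {homo (rearrangement_yx f)^~ t : s s' / (s <= s')%R >-> s' <= s}.
Proof. exact: rearrangement_nonincreasing. Qed.

Lemma rearrangement_yx_nonincreasing2 f s :
  {homo rearrangement_yx f s : t t' / (t <= t')%R >-> t' <= t}.
Proof.
move=> t t' tt'; apply: le_rearrangement => x.
by rewrite !gee0_abs ?rearrangement_ge0//; exact: rearrangement_nonincreasing.
Qed.

Lemma rearrangement_yx_ge0 f s t : 0 <= rearrangement_yx f s t.
Proof. exact: rearrangement_ge0. Qed.

Lemma measurable_rearrangement_yx2 f s (D : set R) : measurable D ->
  measurable_fun D (rearrangement_yx f s).
Proof.
move=> mD; apply: nonincreasing_emeasurable; first by [].
exact: rearrangement_yx_nonincreasing2.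
Qed.

Lemma integral_rearrangement_yx_nonincreasing f t :
  {homo (fun s => \int[mu]_(tau in `]0%R, t[) rearrangement_yx f s tau) :
    s s' / (s <= s')%R >-> s' <= s}.
Proof.
move=> s s' ss'; apply: ge0_le_integral.
- exact: measurable_itv.
- by move=> tau _; exact: rearrangement_yx_ge0.
- by apply: measurable_rearrangement_yx2; exact: measurable_itv.
- by apply: measurable_rearrangement_yx2; exact: measurable_itv.
- by move=> tau _; exact: rearrangement_yx_nonincreasing1.
Qed.

Lemma rearrangement_yx_le_dstar_yx f s t : (0 < s)%R -> (0 < t)%R ->
  rearrangement_yx f s t <= dstar_yx f s t.
Proof.
move=> s0 t0; apply: (@le_trans _ _ (rearrangement (mean_y f t) s)).
  apply: le_rearrangement => x.
  rewrite !gee0_abs ?rearrangement_ge0 ?mean_y_ge0//.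
  apply: nonincreasing_le_mean => // [|tau]; last exact: rearrangement_ge0.
  exact: rearrangement_nonincreasing.
apply: nonincreasing_le_mean => // [|tau]; last exact: rearrangement_ge0.
exact: rearrangement_nonincreasing.
Qed.

Lemma rearrangement_yxD f g s s' t t' :
  rearrangement_yx (f \+ g)%R (s + s')%R (t + t')%R <=
  rearrangement_yx f s t + rearrangement_yx g s' t'.
Proof.
apply: rearrangementD => x; rewrite !gee0_abs ?rearrangement_ge0//.
by apply: rearrangementD => y /=; rewrite lee_fin ler_normD.
Qed.

(** Since the iterated rearrangement is nonincreasing in each variable, its
    integral is controlled by its values at the doubled arguments, to which
    [rearrangement_yxD] applies; each variable costs a factor 2. *)
Lemma dstarD_le f g s t : (0 < s)%R -> (0 < t)%R ->
  dstar (f \+ g)%R s t <= 4%:E * (dstar f s t + dstar g s t).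
Proof.
move=> s0 t0; pose U := rearrangement_yx (f \+ g)%R.
have mU2d a (D : set R) : measurable D -> measurable_fun D (fun b => U a (2 * b)%R).
  move=> mD; apply: (nonincreasing_emeasurable mD) => b b' bb'.
  by apply: rearrangement_yx_nonincreasing2; rewrite ler_pM2l.
have mI (h : R * R -> R) (D : set R) : measurable D ->
    measurable_fun D (fun a => \int[mu]_(tau in `]0%R, t[) rearrangement_yx h a tau).
  move=> mD; apply: (nonincreasing_emeasurable mD).
  exact: integral_rearrangement_yx_nonincreasing.
pose I a := \int[mu]_(tau in `]0%R, t[) U a (2 * tau)%R.
have Ini : {homo I : s s' / (s <= s')%R >-> s' <= s}.
  move=> a a' aa'; apply: ge0_le_integral => //.
  - by move=> tau _; exact: rearrangement_yx_ge0.
  - exact: mU2d.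
  - exact: mU2d.
  - by move=> tau _; exact: rearrangement_yx_nonincreasing1.
have I0 a : 0 <= I a by apply: integral_ge0 => tau _; exact: rearrangement_yx_ge0.
have mId (D : set R) : measurable D -> measurable_fun D (fun a => I (2 * a)%R).
  move=> mD; apply: (nonincreasing_emeasurable mD) => a a' aa'.
  by apply: Ini; rewrite ler_pM2l.
have key : \int[mu]_(sigma in `]0%R, s[) \int[mu]_(tau in `]0%R, t[) U sigma tau
    <= 4%:E * (\int[mu]_(sigma in `]0%R, s[) \int[mu]_(tau in `]0%R, t[) rearrangement_yx f sigma tau
    + \int[mu]_(sigma in `]0%R, s[) \int[mu]_(tau in `]0%R, t[) rearrangement_yx g sigma tau).
  apply: (@le_trans _ _ (\int[mu]_(sigma in `]0%R, s[) (2%:E * I sigma))).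
    apply: ge0_le_integral => //.
    - by move=> sigma _; apply: integral_ge0 => tau _; exact: rearrangement_yx_ge0.
    - exact: mI.
    - by apply: measurable_funeM; exact: nonincreasing_emeasurable.
    - move=> sigma _; apply: (integral_double_le t0) => [|tau].
        exact: rearrangement_yx_nonincreasing2.
      exact: rearrangement_yx_ge0.
  rewrite ge0_integralZl//; last exact: nonincreasing_emeasurable.
  have -> : (4 = 2 * 2 :> R)%R by rewrite -natrM.
  rewrite EFinM -muleA lee_pmul2l//.
  apply: (le_trans (integral_double_le s0 Ini I0)).
  rewrite lee_pmul2l// -ge0_integralD//; last 4 first.
  - by move=> sigma _; apply: integral_ge0 => tau _; exact: rearrangement_yx_ge0.
  - exact: mI.
  - by move=> sigma _; apply: integral_ge0 => tau _; exact: rearrangement_yx_ge0.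
  - exact: mI.
  apply: ge0_le_integral => //.
  - exact: mId.
  - by apply: emeasurable_funD; exact: mI.
  move=> sigma _; rewrite -ge0_integralD//; last 4 first.
  - by move=> tau _; exact: rearrangement_yx_ge0.
  - exact: measurable_rearrangement_yx2.
  - by move=> tau _; exact: rearrangement_yx_ge0.
  - exact: measurable_rearrangement_yx2.
  apply: ge0_le_integral => //.
  - by move=> tau _; exact: rearrangement_yx_ge0.
  - exact: mU2d.
  - by apply: emeasurable_funD; exact: measurable_rearrangement_yx2.
  - by move=> tau _; rewrite !mulr_natl !mulr2n; exact: rearrangement_yxD.
rewrite /dstar -muleDr; last 2 first.
- by rewrite fin_numE.
- apply: ge0_adde_def; rewrite inE; apply: integral_ge0 => sigma _;
    by apply: integral_ge0 => tau _; exact: rearrangement_yx_ge0.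
by rewrite muleCA lee_pmul2l// lte_fin invr_gt0 mulr_gt0.
Qed.

Lemma measurable_rearrangement_y f : measurable_fun setT f ->
  measurable_fun setT (fun z : R * R => rearrangement_y f z.1 z.2).
Proof.
move=> mf; apply: (measurable_rearrangement_family (G := EFin \o f)).
exact/measurable_EFinP.
Qed.

Lemma measurable_rearrangement_yx f : measurable_fun setT f ->
  measurable_fun setT (fun z : R * R => rearrangement_yx f z.1 z.2).
Proof.
move=> mf.
have mswap : measurable_fun setT (fun z : R * R => (z.2, z.1)).
  exact: measurable_fun_pair.
have mFs := measurableT_comp (measurable_rearrangement_y mf) mswap.
exact: measurableT_comp (measurable_rearrangement_family mFs) mswap.
Qed.

Lemma measurable_mean_y f t : measurable_fun setT f ->
  measurable_fun setT (mean_y f t).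
Proof.
move=> mf; apply: measurable_funeM.
apply: (@measurable_fun_integral_section _ _ _ _ _ mu setT `]0%R, t[%classic
  (fun z : R * R => rearrangement_y f z.1 z.2)) => //.
- exact: measurable_rearrangement_y.
- by move=> z; exact: rearrangement_ge0.
Qed.

Lemma mean_yD_le f g t x : measurable_fun setT f -> measurable_fun setT g ->
  (0 < t)%R -> mean_y (f \+ g)%R t x <= mean_y f t x + mean_y g t x.
Proof.
move=> mf mg t0; rewrite /mean_y -ge0_muleDr; last 2 first.
- by apply: integral_ge0 => tau _; exact: rearrangement_ge0.
- by apply: integral_ge0 => tau _; exact: rearrangement_ge0.
rewrite lee_pmul2l//; last by rewrite lte_fin invr_gt0.
have msec (h : R * R -> R) : measurable_fun setT h ->
    measurable_fun setT (fun y => (h (x, y))%:E).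
  by move=> mh; apply/measurable_EFinP; exact: measurable_fun_pair2.
apply: rearrangement_integralD => //.
- exact: msec.
- exact: msec.
- by apply: msec; exact: measurable_funD.
- by move=> y; rewrite /= lee_fin ler_normD.
Qed.

Lemma dstar_yxD_borel f g s t : measurable_fun setT f -> measurable_fun setT g ->
  (0 < s)%R -> (0 < t)%R ->
  dstar_yx (f \+ g)%R s t <= dstar_yx f s t + dstar_yx g s t.
Proof.
move=> mf mg s0 t0; rewrite !dstar_yxE -ge0_muleDr ?rearrangement_integral_ge0//.
rewrite lee_pmul2l//; last by rewrite lte_fin invr_gt0.
apply: (ge0_rearrangement_integralD _ _ _ s0).
- exact: measurable_mean_y.
- exact: measurable_mean_y.
- by apply: measurable_mean_y; exact: measurable_funD.
- by move=> x; exact: mean_y_ge0.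
- by move=> x; exact: mean_y_ge0.
- by move=> x; exact: mean_y_ge0.
- by move=> x; exact: (mean_yD_le x mf mg t0).
Qed.

Lemma dstar_yx_le_dstar_borel f s t : measurable_fun setT f ->
  (0 < s)%R -> (0 < t)%R -> dstar_yx f s t <= dstar f s t.
Proof.
move=> mf s0 t0; rewrite dstar_yxE /dstar invfM EFinM -muleA.
rewrite lee_pmul2l//; last by rewrite lte_fin invr_gt0.
apply: le_trans (rearrangement_integral_scale_le _ _ _) _; first by rewrite invr_gt0.
rewrite lee_pmul2l//; last by rewrite lte_fin invr_gt0.
pose F (z : R * R) := rearrangement_y f z.1 z.2.
have F0 z : 0 <= F z by exact: rearrangement_ge0.
have mF : measurable_fun setT F by exact: measurable_rearrangement_y.
apply: (le_trans (@rearrangement_integral_minkowski R _ _ mu `]0%R, t[%classic F s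
  (measurable_itv _) mF F0 s0)).
pose H (z : R * R) := rearrangement_yx f z.1 z.2.
have H0 z : 0 <= H z by exact: rearrangement_ge0.
have mH : measurable_fun setT H by exact: measurable_rearrangement_yx.
rewrite le_eqVlt; apply/orP; left; apply/eqP; apply: esym.
exact: (@fubini_tonelli_setX _ _ _ _ _ mu mu `]0%R, s[%classic `]0%R, t[%classic H
  (measurable_itv _) (measurable_itv _) mH H0).
Qed.

End iterated_rearrangement.

(** * From Lebesgue to Borel measurable functions *)

Section completion.
Context d (T : measurableType d) (R : realType) (m : {measure set T -> \bar R}).

(** Sets of the completed sigma-algebra are measurable up to a negligible set. *)
Lemma completed_measurable_approx (A : set T) : <<s completed_algebra_gen m >> A ->
  exists2 B, measurable B & m.-negligible ((A `\` B) `|` (B `\` A)).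
Proof.
apply: (@smallest_sub _ _ _ [set A | exists2 B, measurable B &
  m.-negligible ((A `\` B) `|` (B `\` A))]); last first.
  move=> _ [/= B mB [N nN <-]]; exists B => //.
  apply: negligibleS nN => x [[[Bx|//] nBx]|[Bx]]; first by [].
  by move=> /not_orP[].
split.
- by exists set0 => //; rewrite setDv setU0; exact: negligible_set0.
- move=> {}A [B mB nAB]; exists (~` B); first exact: measurableC.
  apply: negligibleS nAB => x [[[_ nAx] /contrapT Bx]|[nBx nAx]].
    by right.
  left; split=> //; apply: contrapT => nA; exact: nAx.
- move=> F mF; pose B n := s2val (cid2 (mF n)).
  have mB n : measurable (B n) by rewrite /B; case: cid2.
  have nB n : m.-negligible ((F n `\` B n) `|` (B n `\` F n)).
    by rewrite /B; case: cid2.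
  exists (\bigcup_n B n); first exact: bigcupT_measurable.
  apply: negligibleS (negligible_bigcup nB) => x [[[n _ Fx] nBx]|[[n _ Bx] nFx]].
    by exists n => //; left; split => // Bx; apply: nBx; exists n.
  by exists n => //; right; split => // Fx; apply: nFx; exists n.
Qed.

(** A function that is measurable for the completed sigma-algebra agrees almost
    everywhere with a function that is measurable for the original one. *)
Lemma completed_measurable_fun_approx (f : T -> R) :
  measurable_fun [set: g_sigma_algebraType (completed_algebra_gen m)]
    (f : g_sigma_algebraType (completed_algebra_gen m) -> R) ->
  exists2 f' : T -> R, measurable_fun setT f' & {ae m, forall x, f x = f' x}.
Proof.
(* [q] enumerates the rationals. *)
move=> mf; pose q (n : nat) : R := ratr (odflt 0%R (unpickle n : option rat)).
have mfq n : <<s completed_algebra_gen m >> (f @^-1` `]q n, +oo[).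
  rewrite -[X in smallest _ _ X]setTI.
  exact: (mf measurableT `]q n, +oo[%classic (measurable_itv _)).
pose B n := s2val (cid2 (completed_measurable_approx (mfq n))).
have mB n : measurable (B n) by rewrite /B; case: cid2.
have nB n : m.-negligible ((f @^-1` `]q n, +oo[ `\` B n) `|` (B n `\` f @^-1` `]q n, +oo[)).
  by rewrite /B; case: cid2.
have [N [mN N0 BN]] := negligible_bigcup nB.
have fB n x : ~ N x -> (q n < f x)%R <-> B n x.
  move=> nNx; split => [qf|Bx]; apply: contrapT => nH; apply: nNx; apply: BN; exists n => //.
    by left; split => //=; rewrite in_itv/= qf.
  by right; split => //=; rewrite in_itv/= andbT.
exists (fun x => if x \in N then 0%R else f x); last first.
  exists N; split => // x /= nfx; apply: contrapT => nNx; apply: nfx.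
  by rewrite memNset.
apply: (measurability _ (RGenOInfty.measurableE R)).
move=> /= _ [_ [r ->] <-]; rewrite setTI.
rewrite (_ : _ @^-1` _ = (N `&` (if (r < 0)%R then setT else set0)) `|`
    (\bigcup_n ((if (r < q n)%R then B n else set0) `\` N))).
  apply: measurableU; first by apply: measurableI => //; case: ifP.
  by apply: bigcupT_measurable => n; apply: measurableD => //; case: ifP.
apply/seteqP; split => [x /=|x].
  rewrite in_itv/= andbT; case: ifPn; rewrite ?inE ?notin_setE => Nx rx.
    by left; split => //; rewrite rx.
  right; have [p] := rat_in_itvoo rx; rewrite in_itv/= => /andP[rp px].
  exists (pickle p) => //; split => //.
  by rewrite /= /q pickleK/= rp; apply/fB => //; rewrite /q pickleK.
move=> [[Nx]|[n _ []]].
  by case: ifP => // r0 _; rewrite /= mem_set// in_itv/= r0.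
case: ifP => // rq Bx Nx; rewrite /= memNset// in_itv/= andbT.
by apply: lt_trans rq _; exact/fB.
Qed.

Lemma measurable_completed_measurable (f : T -> R) : measurable_fun setT f ->
  measurable_fun [set: g_sigma_algebraType (completed_algebra_gen m)]
    (f : g_sigma_algebraType (completed_algebra_gen m) -> R).
Proof.
move=> mf _ Y mY; apply: sub_sigma_algebra; exists (setT `&` f @^-1` Y); first exact: mf.
by exists set0; [exact: negligible_set0|rewrite setU0].
Qed.

End completion.

Section almost_everywhere_equality.
Context {R : realType}.
Local Notation mu := (@lebesgue_measure R).
Implicit Types (f g : R * R -> R) (s t : R).

Lemma rearrangement_ae (h k : R -> \bar R) t :
  {ae mu, forall x, h x = k x} -> rearrangement h t = rearrangement k t.
Proof.
move=> [N [mN N0 hkN]].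
have hk x : ~ N x -> h x = k x by move=> nNx; apply: contrapT => /hkN.
have le (u v : R -> \bar R) : (forall x, ~ N x -> u x = v x) ->
    rearrangement u t <= rearrangement v t.
  move=> uv; apply: le_rearrangement_distribution => r.
  rewrite -[leRHS]adde0 -N0; apply: le_trans (lebesgue_measureU_le _ _).
  apply: lebesgue_measureS => x /= ru.
  by have [Nx|nNx] := pselect (N x); [right|left; rewrite -uv].
by apply/eqP; rewrite eq_le !le// => x /hk.
Qed.

Lemma rearrangement_y_ae f g : {ae (mu \x mu), forall z, f z = g z} ->
  {ae mu, forall x, rearrangement_y f x = rearrangement_y g x}.
Proof.
move=> [N [mN N0 fgN]].
have [M [mM M0 secM]] : {ae mu, forall x, mu (xsection N x) = 0}.
  have msec : measurable_fun setT (mu \o xsection N) by exact: measurable_fun_xsection.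
  have := (ae_eq_integral_abs mu measurableT msec).1.
  have -> : \int[mu]_x `|(mu \o xsection N) x| = (mu \x mu) N.
    by apply: eq_integral => x _; rewrite gee0_abs.
  move=> /(_ N0) [M [mM M0 sM]]; exists M; split => // x /= nx; apply: sM => /=.
  by move=> /(_ I).
exists M; split => // x /= nfg; apply: secM => /= secN; apply: nfg.
apply/funext => t; apply: rearrangement_ae.
exists (xsection N x); split => //; first exact: measurable_xsection.
by move=> y /= nfgy; rewrite /xsection/= inE; apply: fgN => /= fg; apply: nfgy; rewrite fg.
Qed.

Lemma rearrangement_yx_ae f g : {ae (mu \x mu), forall z, f z = g z} ->
  rearrangement_yx f = rearrangement_yx g.
Proof.
move=> /rearrangement_y_ae[N [mN N0 fgN]]; apply/funext => s; apply/funext => t.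
apply: rearrangement_ae; exists N; split => // x /= nfg; apply: fgN => /= fg.
by apply: nfg; rewrite fg.
Qed.

Lemma dstar_ae f g s t : {ae (mu \x mu), forall z, f z = g z} ->
  dstar f s t = dstar g s t.
Proof. by move=> /rearrangement_yx_ae fg; rewrite /dstar fg. Qed.

Lemma dstar_yx_ae f g s t : {ae (mu \x mu), forall z, f z = g z} ->
  dstar_yx f s t = dstar_yx g s t.
Proof.
move=> /rearrangement_y_ae[N [mN N0 fgN]].
suff fg : rearrangement_integral (mean_y f t) s = rearrangement_integral (mean_y g t) s.
  by rewrite (dstar_yxE f) fg.
apply: eq_integral => sigma _; apply: rearrangement_ae; exists N; split => // x /= nfg.
by apply: fgN => /= fg; apply: nfg; rewrite /mean_y fg.
Qed.

Lemma dstar_yxD f g s t : lebesgue_measurable f -> lebesgue_measurable g ->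
  (0 < s)%R -> (0 < t)%R ->
  dstar_yx (f \+ g)%R s t <= dstar_yx f s t + dstar_yx g s t.
Proof.
move=> /completed_measurable_fun_approx[f' mf' ff'].
move=> /completed_measurable_fun_approx[g' mg' gg'] s0 t0.
rewrite (dstar_yx_ae _ _ ff') (dstar_yx_ae _ _ gg').
rewrite (@dstar_yx_ae _ (f' \+ g')%R); first exact: dstar_yxD_borel.
by apply: filterS2 ff' gg' => z /= -> ->.
Qed.

Lemma dstar_yx_le_dstar f s t : lebesgue_measurable f ->
  (0 < s)%R -> (0 < t)%R -> dstar_yx f s t <= dstar f s t.
Proof.
move=> /completed_measurable_fun_approx[f' mf' ff'] s0 t0.
rewrite (dstar_yx_ae _ _ ff') (dstar_ae _ _ ff').
exact: dstar_yx_le_dstar_borel.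
Qed.

End almost_everywhere_equality.

(** * Failure of subadditivity *)

Section example.
Context {R : realType}.
Local Notation mu := (@lebesgue_measure R).
Implicit Types (A B : set (R * R)) (s t : R).

Lemma rearrangement_le_cst (h : R -> \bar R) (r t : R) : (0 <= t)%R ->
  (forall x, `|h x| <= r%:E) -> rearrangement h t <= r%:E.
Proof.
move=> t0 hr; apply: rearrangement_le.
rewrite (_ : [set _ | _] = set0) ?measure0 ?lee_fin//.
by apply/seteqP; split => x //=; rewrite ltNge hr.
Qed.

(** If every section of [A] at fixed [x] has measure at most 1, then the iterated
    rearrangement of its indicator is at most 1 for [tau < 1] and vanishes for
    [tau >= 1], so that its mean over [0, 1] x [0, 2] is at most 1/2. *)
Lemma dstar_indic_le A : (forall x, mu [set y | A (x, y)] <= 1) ->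
  dstar (\1_A : R * R -> R) 1 2 <= (2^-1)%:E.
Proof.
move=> A1; pose U := rearrangement_yx (\1_A : R * R -> R).
have UE s t : (0 < s)%R -> (0 < t)%R -> U s t <= (\1_(`]0%R, 1%R[%classic : set R) t)%:E.
  move=> s0 t0; apply: rearrangement_le_cst; first exact: ltW.
  move=> x; rewrite gee0_abs ?rearrangement_ge0// indicE.
  have [t1|t1] := ltP t 1%R.
    rewrite mem_set/= ?in_itv/= ?t0//; apply: rearrangement_le_cst; first exact: ltW.
    by move=> y; rewrite /= lee_fin indicE; case: (_ \in _); rewrite ?normr1 ?normr0.
  rewrite memNset/= ?in_itv/= ?t0/= ?ltNge ?t1//.
  apply: rearrangement_le; apply: (@le_trans _ _ 1); last by rewrite lee_fin.
  apply: le_trans (A1 x); apply: lebesgue_measureS => y /=.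
  rewrite indicE lte_fin; case: (boolP ((x, y) \in A)); rewrite ?inE//.
  by rewrite normr0 ltxx.
rewrite /dstar mul1r.
rewrite -[leRHS]mule1 lee_pmul2l//.
have in1 s : (0 < s)%R -> \int[mu]_(tau in `]0%R, 2%R[) U s tau <= 1.
  move=> s0; apply: (@le_trans _ _ (\int[mu]_(tau in `]0%R, 2%R[)
      (\1_(`]0%R, 1%R[%classic : set R) tau)%:E)).
    apply: ge0_le_integral => //.
    - by move=> tau _; exact: rearrangement_yx_ge0.
    - exact: measurable_rearrangement_yx2.
    - exact/measurable_EFinP.
    - by move=> tau /=; rewrite in_itv/= => /andP[tau0 _]; exact: UE.
  rewrite integral_indic//; apply: (@le_trans _ _ (mu `]0%R, 1%R[)).
    by apply: lebesgue_measureS => tau [].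
  by rewrite lebesgue_measure_itv/= lte_fin ltr01 sube0.
apply: (@le_trans _ _ (\int[mu]_(sigma in `]0%R, 1%R[) 1)).
  apply: ge0_le_integral => //.
  - by move=> sigma _; apply: integral_ge0 => tau _; exact: rearrangement_yx_ge0.
  - apply: (nonincreasing_emeasurable (measurable_itv _)); exact: integral_rearrangement_yx_nonincreasing.
  - by move=> sigma /=; rewrite in_itv/= => /andP[sigma0 _]; exact: in1.
by rewrite integral_cst_initial// mule1.
Qed.

(* [\1_A] and [\1_B] are the functions of the example: the square [0,1] x [1,2]
   of [B] completes [A] vertically, and [1,2] x [0,1] doubles it. *)
Let A : set (R * R) := `]0%R, 2%R] `*` `]0%R, 1%R].
Let B : set (R * R) := `]0%R, 1%R] `*` `]1%R, 2%R] `|` `]1%R, 2%R] `*` `]0%R, 1%R].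

Let mA : measurable A. Proof. exact: measurableX. Qed.
Let mB : measurable B. Proof. by apply: measurableU; exact: measurableX. Qed.

Let muitv (a b : R) : (a < b)%R -> mu `]a, b] = (b - a)%:E.
Proof. by move=> ab; rewrite lebesgue_measure_itv/= lte_fin ab. Qed.

Let A1 x : mu [set y | A (x, y)] <= 1.
Proof.
apply: (@le_trans _ _ (mu `]0%R, 1%R])); last by rewrite muitv// subr0.
by apply: lebesgue_measureS => y -[].
Qed.

Let B1 x : mu [set y | B (x, y)] <= 1.
Proof.
have [x1|x1] := leP x 1%R.
  apply: (@le_trans _ _ (mu `]1%R, 2%R])); last first.
    by rewrite muitv ?ltr1n// -[2%R]/(1 + 1)%R addrK.
  apply: lebesgue_measureS => y [[]//|[/= ]].
  by rewrite in_itv/= ltNge x1.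
apply: (@le_trans _ _ (mu `]0%R, 1%R])); last by rewrite muitv// subr0.
apply: lebesgue_measureS => y [[/=]|[]//].
by rewrite !in_itv/= leNgt x1 andbF.
Qed.

(** The iterated rearrangements of the two indicators are at most the indicator
    of [tau < 1], while the sections of their sum are 1 on an interval of length 2
    for some [x], and 2 on an interval of length 1 for others: its iterated
    rearrangement takes the larger of the two profiles for every [sigma < 1]. *)
Lemma dstar_not_sublinear : exists f g : R * R -> R,
  [/\ measurable_fun setT f, measurable_fun setT g &
    dstar f 1 2 + dstar g 1 2 < dstar (f \+ g)%R 1 2].
Proof.
exists (\1_A), (\1_B); split => //.
apply: (@le_lt_trans _ _ (2^-1 + 2^-1)%:E).
  by rewrite EFinD leeD// dstar_indic_le.
apply: (@lt_le_trans _ _ ((2^-1) * 3)%:E).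
  by rewrite lte_fin -[X in (X + X)%R]mulr1 -mulrDr ltr_pM2l// -[(1 + 1)%R]/(2%:R) ltr_nat.
pose U := rearrangement_yx (\1_A \+ \1_B : R * R -> R)%R.
have AB1 x y : (0 < x <= 1)%R -> (0 < y <= 2)%R ->
    (1 <= (\1_A (x, y) + \1_B (x, y) : R))%R.
  move=> /andP[x0 x1] /andP[y0 y2].
  have [y1|y1] := leP y 1%R.
    rewrite [X in (X + _)%R]indicE mem_set ?lerDl//.
    by split => /=; rewrite in_itv/= ?x0 ?y0//= (le_trans x1)// ler1n.
  rewrite [X in (_ + X)%R]indicE mem_set ?lerDr//.
  by left; split => /=; rewrite in_itv/= ?x0 ?y1.
have AB2 x y : (1 < x <= 2)%R -> (0 < y <= 1)%R ->
    (2 <= (\1_A (x, y) + \1_B (x, y) : R))%R.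
  move=> /andP[x1 x2] /andP[y0 y1]; rewrite !indicE !mem_set//.
    by right; split => /=; rewrite in_itv/= ?x1 ?y0.
  by split => /=; rewrite in_itv/= ?x2 ?y0// (lt_trans _ x1).
have U1 s t : (s < 1)%R -> (t < 2)%R -> 1 <= U s t.
  move=> s1 t2; apply: rearrangement_ge.
  apply: (@lt_le_trans _ _ (mu `]0%R, 1%R])); first by rewrite muitv// subr0 lte_fin.
  apply: lebesgue_measureS => x /=; rewrite in_itv/= => x01.
  rewrite gee0_abs ?rearrangement_ge0//; apply: rearrangement_ge.
  apply: (@lt_le_trans _ _ (mu `]0%R, 2%R])); first by rewrite muitv// subr0 lte_fin.
  apply: lebesgue_measureS => y /=; rewrite in_itv/= => y02.
  by rewrite lee_fin; apply: le_trans (ler_norm _); exact: AB1.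
have U2 s t : (s < 1)%R -> (t < 1)%R -> 2%:E <= U s t.
  move=> s1 t1; apply: rearrangement_ge.
  apply: (@lt_le_trans _ _ (mu `]1%R, 2%R])).
    by rewrite muitv ?ltr1n// -[2%R]/(1 + 1)%R addrK lte_fin.
  apply: lebesgue_measureS => x /=; rewrite in_itv/= => x12.
  rewrite gee0_abs ?rearrangement_ge0//; apply: rearrangement_ge.
  apply: (@lt_le_trans _ _ (mu `]0%R, 1%R])); first by rewrite muitv// subr0 lte_fin.
  apply: lebesgue_measureS => y /=; rewrite in_itv/= => y01.
  by rewrite lee_fin; apply: le_trans (ler_norm _); exact: AB2.
rewrite /dstar mul1r EFinM lee_pmul2l//.
have in3 s : (s < 1)%R -> 3%:E <= \int[mu]_(tau in `]0%R, 2%R[) U s tau.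
  move=> s1; apply: (@le_trans _ _ (\int[mu]_(tau in `]0%R, 2%R[)
      (1 + (\1_(`]0%R, 1%R[%classic : set R) tau)%:E))).
    rewrite ge0_integralD//; last exact/measurable_EFinP.
    rewrite integral_cst_initial// integral_indic//.
    rewrite setIidl; last by move=> x /=; rewrite !in_itv/= => /andP[-> /lt_trans->]//; rewrite ltr1n.
    have mu01 : mu `]0%R, 1%R[ = 1 by rewrite lebesgue_measure_itv/= lte_fin ltr01 sube0.
    suff : 3%:E <= 1 * 2%:E + mu `]0%R, 1%R[ by [].
    by rewrite mu01 mul1e -EFinD lee_fin natr1.
  apply: ge0_le_integral => //.
  - by move=> tau _; rewrite adde_ge0.
  - by apply: emeasurable_funD => //; exact/measurable_EFinP.
  - exact: measurable_rearrangement_yx2.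
  - move=> tau /=; rewrite in_itv/= => /andP[tau0 tau2]; rewrite indicE.
    have [tau1|tau1] := ltP tau 1%R.
      by rewrite mem_set/= ?in_itv/= ?tau0// -EFinD -[(1 + 1)%R]/(2%R); exact: U2.
    by rewrite memNset/= ?in_itv/= ?tau0/= ?ltNge ?tau1// adde0; exact: U1.
apply: (@le_trans _ _ (\int[mu]_(sigma in `]0%R, 1%R[) 3%:E)).
  by rewrite integral_cst_initial// mule1.
apply: ge0_le_integral => //.
- apply: (nonincreasing_emeasurable (measurable_itv _)); exact: integral_rearrangement_yx_nonincreasing.
- by move=> sigma /=; rewrite in_itv/= => /andP[_ sigma1]; exact: in3.
Qed.

End example.

Theorem proposition2p1 (R : realType) :
  (* 1 *)
  (forall f : R * R -> R, lebesgue_measurable f ->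
    forall s t : R, (0 < s)%R -> (0 < t)%R ->
    rearrangement_yx f s t <= dstar_yx f s t) /\
  (* 2 *)
  (forall f g : R * R -> R, lebesgue_measurable f -> lebesgue_measurable g ->
    forall s t : R, (0 < s)%R -> (0 < t)%R ->
    dstar_yx (f \+ g)%R s t <= dstar_yx f s t + dstar_yx g s t) /\
  (* 3 *)
  ((forall f : R * R -> R, lebesgue_measurable f ->
     forall s t : R, (0 < s)%R -> (0 < t)%R ->
     dstar_yx f s t <= dstar f s t) /\
   (exists f : R * R -> R, lebesgue_measurable f /\
     exists s t : R, [/\ (0 < s)%R, (0 < t)%R & dstar_yx f s t <> dstar f s t])) /\
  (* 4 *)
  ((exists f g : R * R -> R,
     [/\ lebesgue_measurable f, lebesgue_measurable g &
     exists s t : R, [/\ (0 < s)%R, (0 < t)%R &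
       ~ (dstar (f \+ g)%R s t <= dstar f s t + dstar g s t)]]) /\
   (forall f g : R * R -> R, lebesgue_measurable f -> lebesgue_measurable g ->
     forall s t : R, (0 < s)%R -> (0 < t)%R ->
     dstar (f \+ g)%R s t <= 4%:E * (dstar f s t + dstar g s t))).
Proof.
have [f [g [mf mg fg]]] := @dstar_not_sublinear R.
have lf : lebesgue_measurable f by exact: measurable_completed_measurable.
have lg : lebesgue_measurable g by exact: measurable_completed_measurable.
have lfg : lebesgue_measurable (f \+ g)%R.
  by apply: measurable_completed_measurable; exact: measurable_funD.
have lt01 : (0 < 1 :> R)%R by [].
have lt02 : (0 < 2 :> R)%R by [].
split; first by move=> h _ s t; exact: rearrangement_yx_le_dstar_yx.
split; first by move=> h k mh mk s t; exact: dstar_yxD.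
split; last first.
  split; last by move=> h k _ _ s t; exact: dstarD_le.
  exists f, g; split => //; exists 1%R, 2%R; split => //.
  by apply/negP; rewrite -ltNge.
split; first by move=> h mh s t; exact: dstar_yx_le_dstar.
exists (f \+ g)%R; split => //; exists 1%R, 2%R; split => // E.
(* Otherwise [dstar] would inherit the subadditivity of [dstar_yx] at [f + g]. *)
move: fg; rewrite ltNge => /negP; apply.
rewrite -E; apply: le_trans (dstar_yxD lf lg lt01 lt02) _.
by apply: leeD; exact: dstar_yx_le_dstar.
Qed.
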